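(* Let $p\ge 1$ and let $k_{\vec{1}_p}$ be the wordlength equation (k-equation), for $(1/4)^p$th-fraction quaternary-code designs, of the word type $\vec{w}=\vec{1}_p=(1,\ldots,1)$ of length $p$, regarded as a linear form in the frequencies $f_{\vec{i}}$, $\vec{i}\in\mathbb{Z}_4^p$. Let $C_1(p)=\{\vec{i}\in\mathbb{Z}_4^p : i_1+\cdots+i_p\equiv 1 \text{ or } 3 \pmod 4\}$ and $C_2(p)=\{\vec{i}\in\mathbb{Z}_4^p : i_1+\cdots+i_p\equiv 2 \pmod 4\}$. Then $$k_{\vec{1}_p}=1\sum_{\vec{i}\in C_1(p)} f_{\vec{i}}+2\sum_{\vec{i}\in C_2(p)} f_{\vec{i}}.$$
   Context: Write $\mathbb{Z}_4=\{0,1,2,3\}$, and let $L_w$ be the Lee weight on $\mathbb{Z}_4$: $L_w(0)=0$, $L_w(1)=1$, $L_w(2)=2$, $L_w(3)=1$ (arguments are reduced mod 4). For a constant $c$, $\vec{c}_l$ is the vector of length $l$ with all entries $c$. Designs: a $(1/4)^p$th-fraction quaternary-code (QC) design is obtained from an $n\times(n+p)$ generator matrix $G=(V,I_n)$ over $\mathbb{Z}_4$: take all $4^n$ linear combinations over $\mathbb{Z}_4$ of the rows of $G$ and replace each entry by two $\pm1$ entries via the Gray map $0\to(1,1)$, $1\to(1,-1)$, $2\to(-1,-1)$, $3\to(-1,1)$. For $\vec{i}\in\mathbb{Z}_4^p$, $f_{\vec{i}}$ is the number of rows of $V$ equal to $\vec{i}$. A word type is a vector $\vec{w}\in\mathbb{Z}_4^p$;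 it records which of the two columns generated by each column of $V$ enter a word ($w_j=0$: none; $w_j=2$: both; $w_j$ odd: exactly one). The k-equation $k_{\vec{w}}$ is a linear form $\sum_{\vec{i}\in\mathbb{Z}_4^p}c_{\vec{i}}f_{\vec{i}}$ with $c_{\vec{i}}\in\{0,1,2\}$, giving the number of columns generated by $I_n$ that enter the word. Code arithmetic operator: $\bigl(\sum c_{\vec{i}}f_{\vec{i}}\bigr)\oplus\bigl(\sum c'_{\vec{i}}f_{\vec{i}}\bigr)=\sum L_w(c_{\vec{i}}+c'_{\vec{i}})f_{\vec{i}}$. The k-equations (for all $p\ge1$ and $\vec{w}\in\mathbb{Z}_4^p$) are the family of linear forms determined by the following. (Base, $p=1$) $k_0=0$, $k_1=f_1+2f_2+f_3$, $k_2=2f_1+2f_3$. (Rule 1) If $k_{(\vec{w}_l,\vec{w}_{p-l})}=\sum_{(\vec{i}_l,\vec{i}_{p-l})\in\mathbb{Z}_4^p}c_{(\vec{i}_l,\vec{i}_{p-l})}f_{(\vec{i}_l,\vec{i}_{p-l})}$ (vectors split into first $l$ and last $p-l$ entries, $0\le l\le p$), then $k_{(\vec{w}_l,0,\vec{w}_{p-l})}=\sum_{s=0}^3\sum_{(\vec{i}_l,\vec{i}_{p-l})\in\mathbb{Z}_4^p}c_{(\vec{i}_l,\vec{i}_{p-l})}f_{(\vec{i}_l,s,\vec{i}_{p-l})}$. (Rule 2) If $k_{\vec{1}_p}=\sum_{\vec{i}\in\mathbb{Z}_4^p}c_{\vec{i}}f_{(\vec{i}_{p-1},i_p)}$, with $i_p$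 the last entry of $\vec{i}$ and $\vec{i}_{p-1}$ its first $p-1$ entries, then $k_{(1,\vec{3}_p)}=\sum_{s=0}^3\sum_{\vec{i}\in\mathbb{Z}_4^p}c_{\vec{i}}f_{(s,\vec{i}_{p-1},(i_p+s)\bmod 4)}$. (Rule 3) If $s_1=(s_2+2)\bmod 4$, then $k_{(\vec{w}_l,s_2,\vec{w}_{p-l})}=k_{(\vec{w}_l,s_1,\vec{w}_{p-l})}\oplus k_{(\vec{0}_l,2,\vec{0}_{p-l})}$. *)

(* Defs.v *)
From HB Require Import structures.
From mathcomp Require Import all_boot all_order all_algebra.
Set Implicit Arguments.
Unset Strict Implicit.
Unset Printing Implicit Defensive.
Import GRing.Theory.
Local Open Scope ring_scope.

Notation vecZ4 p := 'rV['Z_4]_p.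

Definition Lee (x : 'Z_4) : nat := nth 0%N [:: 0; 1; 2; 1]%N x.

(* A linear form \sum_i c_i f_i in the frequencies f_i, i in Z_4^p, is
   represented by its coefficient function i |-> c_i. The f_i are formal
   variables: an identity between linear forms is an identity between
   coefficients. Scaling by a natural coefficient is written _ *+ c. *)
Notation linform p := {ffun vecZ4 p -> nat}.

Definition freq (p : nat) (i : vecZ4 p) : linform p :=
  [ffun j => nat_of_bool (j == i)].

(* The sum of the coefficients is reduced mod 4 before taking its weight. *)
Definition oplus (p : nat) (c c' : linform p) : linform p :=
  [ffun i => Lee (c i + c' i)%:R].

(* (il, s, ir) *)
Definition insert (l m : nat) (il : vecZ4 l) (s : 'Z_4) (ir : vecZ4 m) :
  vecZ4 (l + (1 + m)) := row_mx il (row_mx (const_mx s) ir).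

(* In length 1, const_mx s is the vector (s). The values k 0 _ are irrelevant:
   rules 1 and 2 start from words of length at least 1. In rules 1 and 3,
   (l, m) stands for (l, p - l); in rule 2, the p of the word (1, 3, ..., 3)
   is q + 1. *)
Record k_equations (k : forall p : nat, vecZ4 p -> linform p) : Prop := {
  keq_coef : forall (p : nat) (w i : vecZ4 p), (0 < p)%N ->
    k p w i \in [:: 0; 1; 2]%N;
  keq_base0 : k 1%N (const_mx 0) = 0;
  keq_base1 : k 1%N (const_mx 1) =
    freq (const_mx 1) + freq (const_mx 2) *+ 2 + freq (const_mx 3);
  keq_base2 : k 1%N (const_mx 2) =
    freq (const_mx 1) *+ 2 + freq (const_mx 3) *+ 2;
  keq_rule1 : forall (l m : nat) (wl : vecZ4 l) (wr : vecZ4 m),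
    (0 < l + m)%N ->
    k _ (insert wl 0 wr) =
    \sum_(s : 'Z_4) \sum_(il : vecZ4 l) \sum_(ir : vecZ4 m)
      freq (insert il s ir) *+ k _ (row_mx wl wr) (row_mx il ir);
  keq_rule2 : forall q : nat,
    k (1 + (q + 1))%N (row_mx (const_mx 1) (const_mx 3)) =
    \sum_(s : 'Z_4) \sum_(i : vecZ4 q) \sum_(t : 'Z_4)
      freq (row_mx (const_mx s) (row_mx i (const_mx (t + s))))
        *+ k (q + 1)%N (const_mx 1) (row_mx i (const_mx t));
  keq_rule3 : forall (l m : nat) (wl : vecZ4 l) (wr : vecZ4 m) (s1 s2 : 'Z_4),
    s1 = s2 + 2 ->
    k _ (insert wl s2 wr) =
    oplus (k _ (insert wl s1 wr)) (k _ (insert (const_mx 0) 2 (const_mx 0)))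
}.

(* The sums are computed in 'Z_4, hence modulo 4. *)
Definition C1 (p : nat) : {set vecZ4 p} :=
  [set i : vecZ4 p | (\sum_j i 0 j == 1) || (\sum_j i 0 j == 3)].

Definition C2 (p : nat) : {set vecZ4 p} := [set i : vecZ4 p | \sum_j i 0 j == 2].

(* Main.v *)
(* More is true: k_w has coefficient Lee (<w, i>) at i, with <w, i> the dot
   product over Z_4, for every word w reached by the rules below. Each rule
   preserves this property: rule 1 pads w with a zero, rule 2 is the identity
   <1_p, (b, c - a)> = - <(1, 3_p), (a, b, c)>, and rule 3 holds because
   Lee (Lee x + Lee (2 y)) = Lee (x + 2 y). Starting from k_1 and k_2, the words
   2 e_j and then (1, 3_p) are reached, and rule 3 turns each 3 into a 1. *)
Require Import Defs.
From mathcomp Require Import all_boot all_order all_algebra.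
From mathcomp Require Import zify ring.
Local Open Scope ring_scope.
Import GRing.Theory.
Set Implicit Arguments.
Unset Strict Implicit.
Unset Printing Implicit Defensive.

Lemma Z4_ind (P : 'Z_4 -> Prop) :
  P 0 -> P 1 -> P 2 -> P 3 -> forall x, P x.
Proof.
move=> P0 P1 P2 P3 [[|[|[|[|m]]]] hm] //.
- by rewrite (_ : Ordinal hm = 0) //; apply: val_inj.
- by rewrite (_ : Ordinal hm = 1) //; apply: val_inj.
- by rewrite (_ : Ordinal hm = 2) //; apply: val_inj.
- by rewrite (_ : Ordinal hm = 3) //; apply: val_inj.
Qed.

Lemma Z4_4 : 4 = 0 :> 'Z_4.
Proof. exact: val_inj. Qed.

Lemma Lee_opp (x : 'Z_4) : Lee (- x) = Lee x.
Proof. by elim/Z4_ind: x. Qed.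

(** Modulo 4, [Lee x] is [x] or [- x], and [Lee (2 * y)] is [2 * y], which is its own negative. So
    the inner weights change the sum at most by a sign, which [Lee] ignores. *)
Lemma Lee_oplus (x y : 'Z_4) : Lee (Lee x + Lee (2 * y))%:R = Lee (x + 2 * y).
Proof. by elim/Z4_ind: x; elim/Z4_ind: y. Qed.

(** With [x] the sum of the entries of a vector, the two terms are the indicators of [C1] and [C2],
    weighted 1 and 2. *)
Lemma LeeE (x : 'Z_4) :
  Lee x = (((x == 1)%R || (x == 3)%R) + (x == 2)%R * 2)%N.
Proof. by elim/Z4_ind: x. Qed.

Lemma linform_sumE p (I : Type) (r : seq I) (P : pred I) (F : I -> linform p) i :
  (\sum_(x <- r | P x) F x) i = \sum_(x <- r | P x) F x i.
Proof. by elim/big_rec2: _ => [|x y1 y2 _ <-]; rewrite ffunE. Qed.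

Lemma linform_addE p (c d : linform p) i : (c + d) i = (c i + d i)%N.
Proof. by rewrite ffunE. Qed.

Lemma linform_mulnE p (c : linform p) n i : (c *+ n) i = (c i * n)%N.
Proof.
elim: n => [|n IHn]; first by rewrite mulr0n muln0 ffunE.
by rewrite mulrSr linform_addE IHn mulnSr.
Qed.

(** Reads off a coefficient of the right-hand side of rule 1 or 2: distinct indices there give
    distinct variables, so a single term contributes. *)
Lemma sum_freq_inj p (T : finType) (F : T -> vecZ4 p) (c : T -> nat) y :
  injective F -> (\sum_x freq (F x) *+ c x) (F y) = c y.
Proof.
move=> injF; rewrite linform_sumE (bigD1 y) //= big1 => [|x nxy].
  by rewrite addr0 linform_mulnE ffunE eqxx mul1n.
by rewrite linform_mulnE ffunE (inj_eq injF) eq_sym (negPf nxy).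
Qed.

Lemma sum_freq_in p (A : {set vecZ4 p}) i : (\sum_(x in A) freq x) i = (i \in A).
Proof.
rewrite linform_sumE; have [iA|niA] := boolP (i \in A).
  rewrite (bigD1 i) //= ffunE eqxx big1 // => x /andP[_ nxi].
  by rewrite ffunE eq_sym (negPf nxi).
rewrite big1 // => x xA; rewrite ffunE; case: eqP => // eix.
by rewrite eix xA in niA.
Qed.

Lemma const_mx1_eq (a b : 'Z_4) :
  (const_mx a == const_mx b :> vecZ4 1) = (a == b).
Proof. by apply/eqP/eqP=> [/rowP/(_ 0)|->//]; rewrite !mxE. Qed.

Lemma const_mx1K (i : vecZ4 1) : i = const_mx (i 0 0).
Proof. by apply/rowP=> j; rewrite ord1 mxE. Qed.

Lemma insertK l m (i : vecZ4 (l + (1 + m))) :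
  insert (lsubmx i) (lsubmx (rsubmx i) 0 0) (rsubmx (rsubmx i)) = i.
Proof.
rewrite /insert -[RHS]hsubmxK -[X in _ = row_mx _ X]hsubmxK.
by congr (row_mx _ (row_mx _ _)); apply/rowP=> j; rewrite !ord1 mxE.
Qed.

Lemma insert_constE l m (a s b : 'Z_4) (j : 'I_(l + (1 + m))) :
  insert (const_mx a : vecZ4 l) s (const_mx b : vecZ4 m) 0 j =
  if (j < l)%N then a else if j == l :> nat then s else b.
Proof.
rewrite /insert mxE; case: splitP => x ej; rewrite mxE // ej.
case: splitP => y ->; rewrite mxE; first by rewrite ord1 addn0 eqxx.
by case: eqP => //; lia.
Qed.

Definition dot p (w i : vecZ4 p) : 'Z_4 := (w *m i^T) 0 0.

Lemma dotE p (w i : vecZ4 p) : dot w i = \sum_j w 0 j * i 0 j.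
Proof. by rewrite /dot mxE; apply: eq_bigr => j _; rewrite mxE. Qed.

Lemma dot_row_mx l m (a c : vecZ4 l) (b d : vecZ4 m) :
  dot (row_mx a b) (row_mx c d) = dot a c + dot b d.
Proof. by rewrite /dot tr_row_mx mul_row_col mxE. Qed.

Lemma dot_const1 (s t : 'Z_4) :
  dot (const_mx s : vecZ4 1) (const_mx t) = s * t.
Proof. by rewrite dotE big_ord1 !mxE. Qed.

Lemma dot_const_l p (s : 'Z_4) (i : vecZ4 p) :
  dot (const_mx s) i = s * dot (const_mx 1) i.
Proof.
by rewrite !dotE mulr_sumr; apply: eq_bigr => j _; rewrite !mxE mul1r.
Qed.

Lemma dot_insert l m (a c : vecZ4 l) (s t : 'Z_4) (b d : vecZ4 m) :
  dot (insert a s b) (insert c t d) = dot a c + (s * t + dot b d).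
Proof. by rewrite !dot_row_mx dot_const1. Qed.

Section Rules.

Variables (k : forall q : nat, vecZ4 q -> linform q) (hk : k_equations k).

Definition lee_form p (w : vecZ4 p) := forall i, k w i = Lee (dot w i).

Lemma lee_form1 : lee_form (const_mx 1 : vecZ4 1).
Proof.
move=> i; rewrite (const_mx1K i) dot_const1 (keq_base1 hk) !linform_addE !ffunE.
by rewrite !const_mx1_eq; elim/Z4_ind: (i 0 0).
Qed.

Lemma lee_form2 : lee_form (const_mx 2 : vecZ4 1).
Proof.
move=> i; rewrite (const_mx1K i) dot_const1 (keq_base2 hk) !linform_addE !ffunE.
by rewrite !const_mx1_eq; elim/Z4_ind: (i 0 0).
Qed.

Lemma lee_form_insert0 l m (a : vecZ4 l) (b : vecZ4 m) :
  (0 < l + m)%N -> lee_form (row_mx a b) -> lee_form (insert a 0 b).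
Proof.
move=> lm0 Hab i; rewrite (keq_rule1 hk) //.
(* The nested sums become one sum over triples, whose index map [F] below is injective. *)
rewrite pair_bigA pair_bigA /= -(insertK i) dot_insert mul0r add0r.
set c := lsubmx i; set s := lsubmx _ 0 0; set d := rsubmx (rsubmx i).
pose F (x : 'Z_4 * vecZ4 l * vecZ4 m) := insert x.1.2 x.1.1 x.2.
have injF : injective F.
  move=> [[s1 c1] d1] [[s2 c2] d2] /eq_row_mx[/= -> /eq_row_mx[+ ->]].
  by move/rowP/(_ 0); rewrite !mxE => ->.
have := @sum_freq_inj _ _ F (fun x => k (row_mx a b) (row_mx x.1.2 x.2))
  (s, c, d) injF.
by rewrite /F /= => ->; rewrite Hab dot_row_mx.
Qed.

(** Starting from the word (2) of length 1, rule 1 first pads zeros on the right (induction on [m]),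
    then on the left (induction on [l]). *)
Lemma lee_form_insert2 l m :
  lee_form (insert (const_mx 0 : vecZ4 l) 2 (const_mx 0 : vecZ4 m)).
Proof.
elim: l => [|l IHl].
  elim: m => [|m IHm].
    suff <- : const_mx 2 = insert (const_mx 0 : vecZ4 0) 2 (const_mx 0 : vecZ4 0).
      exact: lee_form2.
    by apply/rowP=> j; rewrite insert_constE mxE ord1.
  (* The new zero is inserted directly after the leading 2. *)
  suff -> : insert (const_mx 0 : vecZ4 0) 2 (const_mx 0 : vecZ4 m.+1) =
            insert (const_mx 2 : vecZ4 1) 0 (const_mx 0 : vecZ4 m).
    apply: (@lee_form_insert0 1 m) => //.
    suff -> : row_mx (const_mx 2 : vecZ4 1) (const_mx 0 : vecZ4 m) =
              insert (const_mx 0 : vecZ4 0) 2 (const_mx 0 : vecZ4 m) by [].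
    apply/rowP=> j; rewrite [RHS](@insert_constE 0 m _ _ _ j) mxE.
    by rewrite ltn0; case: (@splitP 1 m j) => x ->; rewrite mxE ?ord1.
  apply/rowP=> j; rewrite (@insert_constE 0 m.+1 _ _ _ j).
  rewrite [RHS](@insert_constE 1 m _ _ _ j) ltnS leqn0.
  by case: eqP => //; case: eqP.
(* The new zero is inserted in front, with an empty left block. *)
suff -> : insert (const_mx 0 : vecZ4 l.+1) 2 (const_mx 0 : vecZ4 m) =
          insert (const_mx 0 : vecZ4 0) 0
            (insert (const_mx 0 : vecZ4 l) 2 (const_mx 0 : vecZ4 m)).
  apply: (@lee_form_insert0 0 (l + (1 + m))); first by rewrite add0n addnCA.
  suff -> : row_mx (const_mx 0 : vecZ4 0) (insert (const_mx 0) 2 (const_mx 0)) =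
            insert (const_mx 0 : vecZ4 l) 2 (const_mx 0 : vecZ4 m) by [].
  apply/rowP=> j; rewrite mxE; case: splitP => [[]//|x ejx].
  by congr (insert _ _ _ _ _); apply: val_inj.
apply/rowP=> j; rewrite (@insert_constE l.+1 m _ _ _ j) {1}/insert mxE.
case: (@splitP 0 (1 + (l + (1 + m))) j) => [[]//|x ->].
rewrite mxE; case: (@splitP 1 (l + (1 + m)) x) => y ->; first by rewrite mxE ord1.
by rewrite insert_constE.
Qed.

(** This is rule 3 with [s2] the entry of [w] at [j] and [s1 = s2 + 2]. The raised entry and the
    word 2 e_j each contribute [2 * i 0 j] to the dot product, and together these vanish modulo
    4. *)
Lemma lee_form_add2 p (w : vecZ4 p) (j : 'I_p) :
  lee_form (w + 2 *: delta_mx 0 j) -> lee_form w.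
Proof.
(* Cutting the length at [j] gives the shape [l + (1 + m)] that [insert] requires. *)
have [l [m [ep ej]]] : exists l m, p = (l + (1 + m))%N /\ j = l :> nat.
  by exists j, (p - j.+1)%N; have := ltn_ord j; lia.
subst p; move=> H i.
have Ew : w + 2 *: delta_mx 0 j =
    insert (lsubmx w) (lsubmx (rsubmx w) 0 0 + 2) (rsubmx (rsubmx w)).
  rewrite -{1}(insertK w).
  have -> : 2 *: delta_mx 0 j =
      insert (const_mx 0 : vecZ4 l) 2 (const_mx 0 : vecZ4 m).
    apply/rowP=> x; rewrite insert_constE !mxE eqxx -val_eqE /= ej.
    by case: ltngtP => _; rewrite /= ?mulr0 ?mulr1.
  by rewrite /insert !add_row_mx; congr (row_mx _ (row_mx _ _));
    apply/rowP=> x; rewrite !mxE ?addr0.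
rewrite Ew in H; rewrite -(insertK w) (keq_rule3 hk _ _ (erefl _)) ffunE H.
rewrite lee_form_insert2 -(insertK i) !dot_insert.
rewrite (dot_const_l 0 (lsubmx i)) (dot_const_l 0 (rsubmx (rsubmx i))).
rewrite !mul0r add0r addr0 Lee_oplus; congr Lee.
set t := lsubmx (rsubmx i) 0 0; ring: Z4_4.
Qed.

Lemma lee_form_rule2 q :
  lee_form (const_mx 1 : vecZ4 (q + 1)) ->
  lee_form (row_mx (const_mx 1 : vecZ4 1) (const_mx 3 : vecZ4 (q + 1))).
Proof.
move=> H i; rewrite (keq_rule2 hk) pair_bigA pair_bigA /=.
pose F (x : 'Z_4 * vecZ4 q * 'Z_4) : vecZ4 (1 + (q + 1)) :=
  row_mx (const_mx x.1.1) (row_mx x.1.2 (const_mx (x.2 + x.1.1))).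
have injF : injective F.
  move=> [[s1 c1] t1] [[s2 c2] t2] /eq_row_mx[/= Es /eq_row_mx[-> Et]].
  by move/rowP/(_ 0): Es Et; rewrite !mxE => -> /rowP/(_ 0); rewrite !mxE => /addIr ->.
set s := lsubmx i 0 0; set b := lsubmx (rsubmx i).
set c := rsubmx (rsubmx i) 0 0.
(* Rule 2 shifts the last entry by [s], so the coefficient at [i] comes from the index whose last
   entry is [c - s]. *)
have -> : i = F (s, b, c - s).
  rewrite /F /= subrK -[LHS]hsubmxK -[X in row_mx _ X = _]hsubmxK.
  by congr (row_mx _ (row_mx b _)); apply/rowP=> j; rewrite ord1 [RHS]mxE.
have := @sum_freq_inj _ _ F
  (fun x => @k (q + 1)%N (const_mx 1) (row_mx x.1.2 (const_mx x.2)))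
  (s, b, c - s) injF.
rewrite {1}/F /= => ->; rewrite H /F /= subrK.
have E (r : 'Z_4) : const_mx r = row_mx (const_mx r : vecZ4 q) (const_mx r : vecZ4 1).
  by rewrite row_mx_const.
(* Since 3 is -1, the two dot products are opposite, and [Lee] is even. *)
rewrite !E !dot_row_mx !dot_const1 (dot_const_l 3) -Lee_opp; congr Lee.
have -> : 3 = - 1 :> 'Z_4 by exact: val_inj.
by rewrite !mulN1r !mul1r opprD opprB addrCA.
Qed.

Lemma lee_form_ones p : (0 < p)%N -> lee_form (const_mx 1 : vecZ4 p).
Proof.
elim: p => [//|[_ _|p IHp _]]; first exact: lee_form1.
(* These words interpolate between (1, 3, ..., 3) at [n = 0], which rule 2 supplies from the ones of
   length [p.+1], and the all-ones word at [n = p.+1]. *)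
suff H n : (n <= p.+1)%N ->
    lee_form (\row_(j < p.+2) if (j < n.+1)%N then 1 else 3).
  have -> : const_mx 1 = \row_(j < p.+2) if (j < p.+2)%N then 1 else 3 :> 'Z_4.
    by apply/rowP=> j; rewrite !mxE ltn_ord.
  exact: H.
elim: n => [_|n IHn lt_np].
  have := @lee_form_rule2 p; rewrite addn1 => /(_ (IHp isT)).
  congr lee_form; apply/rowP=> j; rewrite !mxE.
  by case: splitP => x ->; rewrite mxE ?ord1.
(* Adding 2 to the last of the leading ones, at index [n.+1], restores the 3 of the preceding
   word. *)
apply: (@lee_form_add2 _ _ (Ordinal (lt_np : (n.+1 < p.+2)%N))).
have := IHn (ltnW lt_np); congr lee_form.
apply/rowP=> j; rewrite !mxE eqxx -val_eqE /= [in RHS]ltnS [in RHS]leq_eqVlt.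
case: eqP => [->|_]; first by rewrite ltnn mulr1; apply: val_inj.
by rewrite mulr0 addr0.
Qed.

End Rules.

Theorem theorem1 (p : nat) (hp : (0 < p)%N)
    (k : forall q : nat, vecZ4 q -> linform q) (hk : k_equations k) :
  k p (const_mx 1) =
  (\sum_(i in C1 p) freq i) *+ 1 + (\sum_(i in C2 p) freq i) *+ 2.
Proof.
apply/ffunP=> i; rewrite (lee_form_ones hk hp).
rewrite linform_addE !linform_mulnE !sum_freq_in !inE muln1 -LeeE dotE.
by congr Lee; apply: eq_bigr => j _; rewrite mxE mul1r.
Qed.
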